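(* If $G$ is a threshold graph, then $D(G)$ is equal to the size (number of vertices) of the largest component in the compact canonical decomposition of $G$.
   Context: All graphs are finite, simple and undirected. A labeling $\phi: V(G)\to\{1,\dots,c\}$ is distinguishing if for every non-trivial automorphism $\pi$ of $G$ there is a vertex $v$ with $\phi(v)\neq\phi(\pi(v))$. The distinguishing number $D(G)$ is the smallest $c$ such that $G$ has a distinguishing $c$-labeling. A threshold graph is a graph that can be constructed from the empty graph by repeatedly adding an isolated vertex or a dominating vertex (one adjacent to all the vertices already present). A graph is split if its vertex set can be partitioned as $A\cup B$ with $A$ inducing a complete graph and $B$ a stable set (one of $A,B$ may be empty); $(A,B)$ is a $KS$-partition, and $(G,A,B)$ denotes a split graph $G$ with a fixed $KS$-partition. If $V(G)\cap V(H)=\emptyset$, the composition $(G,A,B)\circ H$ is the graph with vertex set $V(G)\cup V(H)$ and edge set $E(G)\cup E(H)\cup\{uv: u\in A, v\in V(H)\}$. If $H$ is split with $KS$-partition $(C,D)$, then $(G,A,B)\circ(H,C,D)$ is the composition graph with $KS$-partition $(A\cup C,B\cup D)$; the operation is associative. A graph is decomposable if it equals $(G,A,B)\circ H$ with $G$ and $H$ each having at least one vertex; otherwise it is indecomposable. Canonical decomposition (Tyshkevich): every graph $G$ can be written as $(G_r,A_r,B_r)\circ\cdots\circ(G_1,A_1,B_1)\circ G_0$ with every $G_i$ indecomposable, and this is unique up to isomorphism (isomorphisms of triples respect the $KS$-partitions). A component is trivial if it has exactly one vertex. A trivial component $G_i$ with $i\ge 1$ has type $K_1$ if its vertex is in $A_i$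 and type $S_1$ if its vertex is in $B_i$. If $G_0$ and $G_1$ are both trivial, $G_0$ is given the type of $G_1$; if $G_0$ is trivial but $G_1$ is non-trivial or does not exist, $G_0$ is given no type and is left alone. Compact canonical decomposition: obtained from the canonical decomposition by replacing each maximal run of $m$ consecutive trivial components of type $K_1$ by the complete graph on those $m$ vertices with $KS$-partition (all vertices, $\emptyset$), and each maximal run of $m$ consecutive trivial components of type $S_1$ by the edgeless graph on those $m$ vertices with $KS$-partition ($\emptyset$, all vertices). (If the run includes the last component $G_0$, the result is the new last component.) *)

(* Defs.v *)
From mathcomp Require Import all_boot all_fingroup.

Set Implicit Arguments.
Unset Strict Implicit.
Unset Printing Implicit Defensive.

Record sgraph := SGraph {
  vertex :> finType;
  adj : rel vertex;
  adj_sym : symmetric adj;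
  adj_irr : irreflexive adj }.

Definition isomorphic (G H : sgraph) : Prop :=
  exists2 f : G -> H, bijective f & forall u v, adj (f u) (f v) = adj u v.

Definition automorphism (G : sgraph) (p : {perm G}) : bool :=
  [forall u, forall v, adj (p u) (p v) == adj u v].

(* The c labels are the elements 0, ..., c - 1 of 'I_c. *)
Definition distinguishing (G : sgraph) (c : nat) (phi : {ffun G -> 'I_c}) : bool :=
  [forall p : {perm G}, automorphism p && (p != 1%g) ==>
     [exists v, phi v != phi (p v)]].

Lemma distinguishing_ex (G : sgraph) :
  exists c, [exists phi : {ffun G -> 'I_c}, distinguishing phi].
Proof.
exists #|G|; apply/existsP; exists [ffun v => enum_rank v].
apply/forallP => p; apply/implyP => /andP[_]; apply: contraNT.
rewrite negb_exists => /forallP fix_p; apply/eqP/permP => v.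
by move: (fix_p v); rewrite !ffunE negbK perm1 => /eqP/enum_rank_inj.
Qed.

Definition distinguishing_number (G : sgraph) : nat :=
  ex_minn (distinguishing_ex G).

Definition empty_adj (u v : void) : bool := false.
Lemma empty_adj_sym : symmetric empty_adj. Proof. by []. Qed.
Lemma empty_adj_irr : irreflexive empty_adj. Proof. by []. Qed.
Definition empty_graph : sgraph := SGraph empty_adj_sym empty_adj_irr.

Section AddVertex.
Variables (dominating : bool) (G : sgraph).

Definition add_adj (u v : option G) : bool :=
  match u, v with
  | Some u', Some v' => adj u' v'
  | None, None => false
  | _, _ => dominating
  end.

Lemma add_adj_sym : symmetric add_adj.
Proof. by move=> [u|] [v|] //=; apply: adj_sym. Qed.
Lemma add_adj_irr : irreflexive add_adj.
Proof. by move=> [u|] //=; apply: adj_irr. Qed.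

(* The new vertex None is dominating or isolated, according to the boolean. *)
Definition add_vertex : sgraph := SGraph add_adj_sym add_adj_irr.
End AddVertex.

Definition threshold (G : sgraph) : Prop :=
  exists bs : seq bool, isomorphic G (foldr add_vertex empty_graph bs).

(* A split graph (G, A, B) with a fixed KS-partition; B is determined by A. *)
Record ksgraph := KSGraph {
  ksval :> sgraph;
  ksA : {set ksval};
  ksA_clique : {in ksA &, forall u v, u != v -> adj u v};
  ksB_stable : {in ~: ksA &, forall u v, ~~ adj u v} }.

Definition ksB (G : ksgraph) : {set G} := ~: ksA G.

Section Composition.
Variables (G : ksgraph) (H : sgraph).

Definition comp_adj (x y : G + H) : bool :=
  match x, y with
  | inl u, inl v => adj u v
  | inr u, inr v => adj u v
  | inl u, inr _ | inr _, inl u => u \in ksA G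
  end.

Lemma comp_adj_sym : symmetric comp_adj.
Proof. by move=> [u|u] [v|v] //=; apply: adj_sym. Qed.
Lemma comp_adj_irr : irreflexive comp_adj.
Proof. by move=> [u|u] //=; apply: adj_irr. Qed.

Definition comp : sgraph := SGraph comp_adj_sym comp_adj_irr.
End Composition.

Definition decomposable (G : sgraph) : Prop :=
  exists (H : ksgraph) (K : sgraph),
    [/\ 0 < #|H|, 0 < #|K| & isomorphic G (comp H K)].

Definition indecomposable (G : sgraph) : Prop := ~ decomposable G.

(* ([:: G_r; ...; G_1], G_0) *)
Definition decomposition := (seq ksgraph * sgraph)%type.

(* The operation is associative, so bracketing to the right is harmless. *)
Definition recompose (d : decomposition) : sgraph := foldr comp d.2 d.1.

Fixpoint all_components (P : sgraph -> Prop) (s : seq ksgraph) (G0 : sgraph) : Prop :=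
  if s is G :: s' then P G /\ all_components P s' G0 else P G0.

(* Components have at least one vertex, except that the graph without vertices
   is its own only component. *)
Definition canonical_decomposition (G : sgraph) (d : decomposition) : Prop :=
  [/\ isomorphic G (recompose d),
      all_components indecomposable d.1 d.2
    & d.1 <> [::] -> all_components (fun H => 0 < #|H|) d.1 d.2].

Variant ctype := K1 | S1.

Definition is_K1 (t : ctype) : bool := if t is K1 then true else false.

Definition trivial_type (G : ksgraph) : option ctype :=
  if #|G| == 1 then Some (if ksA G == [set: G] then K1 else S1) else None.

Section Run.
Variables (t : ctype) (m : nat).

Definition run_adj (i j : 'I_m) : bool := is_K1 t && (i != j).

Lemma run_adj_sym : symmetric run_adj.
Proof. by move=> i j; rewrite /run_adj eq_sym. Qed.
Lemma run_adj_irr : irreflexive run_adj.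
Proof. by move=> i; rewrite /run_adj eqxx andbF. Qed.

Definition run_graph : sgraph := SGraph run_adj_sym run_adj_irr.

Definition run_A : {set run_graph} := [set i | is_K1 t].

Lemma run_A_clique : {in run_A &, forall u v, u != v -> adj u v}.
Proof. by move=> u v; rewrite inE /= /run_adj => ->. Qed.
Lemma run_B_stable : {in ~: run_A &, forall u v, ~~ adj u v}.
Proof. by move=> u v; rewrite !inE /= /run_adj => /negbTE ->. Qed.

(* K_m with KS-partition (V, empty) for K1; its complement with
   KS-partition (empty, V) for S1. *)
Definition run : ksgraph := KSGraph run_A_clique run_B_stable.
End Run.

(* Scan G_r, ..., G_0. The argument [pending] is the type and length of the
   run ending just before the current component, if there is one. When G_0 is
   reached, a pending run means precisely that G_1 exists and is trivial, so a
   trivial G_0 then takes its type and joins the run. *)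
Fixpoint compact_scan (pending : option (ctype * nat)) (s : seq ksgraph)
    (G0 : sgraph) : decomposition :=
  match s with
  | [::] =>
      match pending with
      | Some (t, m) =>
          if #|G0| == 1 then ([::], run t m.+1 : sgraph) else ([:: run t m], G0)
      | None => ([::], G0)
      end
  | G :: s' =>
      let flush := if pending is Some (t, m) then [:: run t m] else [::] in
      let prepend p d := (p ++ d.1, d.2) in
      match trivial_type G, pending with
      | None, _ => prepend (rcons flush G) (compact_scan None s' G0)
      | Some t, Some (t', m) =>
          if is_K1 t == is_K1 t' then compact_scan (Some (t, m.+1)) s' G0
          else prepend flush (compact_scan (Some (t, 1)) s' G0)
      | Some t, None => compact_scan (Some (t, 1)) s' G0
      end
  end.

Definition compact (d : decomposition) : decomposition :=
  compact_scan None d.1 d.2.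

Definition largest_component (d : decomposition) : nat :=
  maxn #|d.2| (\max_(G <- d.1) #|G|).

Lemma isomorphic_refl (G : sgraph) : isomorphic G G.
Proof. by exists (fun u => u) => //; exists (fun u => u). Qed.

Lemma isomorphic_trans (G H K : sgraph) :
  isomorphic G H -> isomorphic H K -> isomorphic G K.
Proof.
move=> [f bij_f fP] [g bij_g gP]; exists (g \o f); first exact: bij_comp.
by move=> u v /=; rewrite gP fP.
Qed.

Lemma isomorphic_card (G H : sgraph) : isomorphic G H -> #|G| = #|H|.
Proof. by case=> f bij_f _; apply: bij_eq_card bij_f. Qed.

Lemma small_indecomposable (G : sgraph) : #|G| <= 1 -> indecomposable G.
Proof.
move=> leG1 [H [K [H_gt0 K_gt0 /isomorphic_card eqG]]].
by move: leG1; rewrite eqG card_sum leqNgt (@leq_add 1 1).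
Qed.

Lemma comp_run1 (b : bool) (G H : sgraph) : isomorphic G H ->
  isomorphic (add_vertex b G) (comp (run (if b then K1 else S1) 1) H).
Proof.
case=> f [g fK gK] fP.
exists (fun x : option G => if x is Some u then inr (f u) else inl ord0).
  exists (fun y => if y is inr v then Some (g v) else None).
    by case=> [u|] //; rewrite fK.
  by case=> [i|v]; rewrite ?gK ?[i]ord1.
have in_run1 : (ord0 : run_graph (if b then K1 else S1) 1)
    \in run_A (if b then K1 else S1) 1 = b by rewrite inE; case: b.
by case=> [u|] [v|] //=; rewrite ?fP ?in_run1 // /run_adj eqxx andbF.
Qed.

Lemma threshold_canonical_decomposition (G : sgraph) :
  threshold G -> exists d, canonical_decomposition G d.
Proof.
case=> bs; case: bs => [|b bs] isoG.
  exists ([::], G); split=> //=; first exact: isomorphic_refl.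
  by apply: small_indecomposable; rewrite (isomorphic_card isoG) card_void.
suff [d [isod indd posd]] : exists d : decomposition,
    [/\ isomorphic (foldr add_vertex empty_graph (b :: bs)) (recompose d),
        all_components indecomposable d.1 d.2
      & all_components (fun H => 0 < #|H|) d.1 d.2].
  by exists d; split=> //; apply: isomorphic_trans isoG isod.
elim: bs b {isoG} => [|b' bs IH] b.
  exists ([::], add_vertex b empty_graph).
  have card1 : #|add_vertex b empty_graph| = 1 by rewrite card_option card_void.
  split=> /=; last by rewrite card1.
  - exact: isomorphic_refl.
  - by apply: small_indecomposable; rewrite card1.
have [[s G0] [isod indd posd]] := IH b'.
exists (run (if b then K1 else S1) 1 :: s, G0).
split; first exact: comp_run1.
  by split=> //; apply: small_indecomposable; rewrite card_ord.
by split=> //; rewrite card_ord.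
Qed.

(* Main.v *)
(* All canonical components of a threshold graph are trivial: each is an
   induced subgraph, so it has a dominating or an isolated vertex and, if it
   has two vertices or more, it is decomposable. Hence the vertices can be
   numbered so that the adjacency of two of them depends only on the type of
   the first one, and the runs of equal types are exactly the classes of
   twins. Exchanging two twins is an automorphism, so twins need distinct
   labels. Conversely the neighbourhoods of any two vertices are nested, so a
   vertex and its image under an automorphism, having the same degree, are
   twins; a labeling injective on each class of twins is thus distinguishing. *)
Require Import Defs.
From mathcomp Require Import all_boot all_fingroup zify.

Set Implicit Arguments.
Unset Strict Implicit.
Unset Printing Implicit Defensive.

(** * Twins, nested neighbourhoods and the distinguishing number *)

Definition twins (G : sgraph) (u v : G) : Prop :=
  forall w, w != u -> w != v -> adj u w = adj v w.

(** The vicinal preorder; it is total exactly on threshold graphs, and twins are its equivalent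
    elements. *)
Definition dominated (G : sgraph) (u v : G) : Prop :=
  forall w, w != u -> w != v -> adj u w -> adj v w.

Lemma automorphismP (G : sgraph) (p : {perm G}) :
  reflect (forall u v, adj (p u) (p v) = adj u v) (automorphism p).
Proof.
apply: (iffP forallP) => [aut_p u v | aut_p u].
  by have /forallP/(_ v)/eqP := aut_p u.
by apply/forallP => v; apply/eqP.
Qed.

Lemma twins_tperm (G : sgraph) (u v : G) :
  twins u v -> automorphism (tperm u v).
Proof.
move=> twin_uv; apply/automorphismP => x y.
case: tpermP => [->|->|/eqP xu /eqP xv];
  case: tpermP => [->|->|/eqP yu /eqP yv] //; rewrite ?adj_irr //.
- exact: adj_sym.
- by rewrite twin_uv.
- exact: adj_sym.
- by rewrite twin_uv.
- by rewrite ![adj x _]adj_sym twin_uv.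
- by rewrite ![adj x _]adj_sym twin_uv.
Qed.

Lemma distinguishing_twins (G : sgraph) c (phi : {ffun G -> 'I_c}) (u v : G) :
  distinguishing phi -> twins u v -> phi u = phi v -> u = v.
Proof.
move=> /forallP/(_ (tperm u v)) dist_phi twin_uv phi_uv.
apply/eqP; apply: contraTT dist_phi => neq_uv.
rewrite negb_imply twins_tperm //=; apply/andP; split.
  by apply: contraNneq neq_uv => /permP/(_ u); rewrite tpermL perm1 => ->.
rewrite negb_exists; apply/forallP => w; rewrite negbK.
by case: tpermP => [->|->|]; rewrite ?phi_uv.
Qed.

(** A possible edge [uv] counts equally in both degrees, so the neighbourhoods outside [u] and [v]
    are nested sets of the same size. *)
Lemma dominated_degree (G : sgraph) (u v : G) :
  dominated u v -> #|adj u| = #|adj v| -> twins u v.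
Proof.
move=> dom_uv deg_uv w wu wv.
pose A := [set x | adj u x & x != v]; pose B := [set x | adj v x & x != u].
have card_nbr (x y : G) : #|adj x| = adj x y + #|[set z | adj x z & z != y]|.
  rewrite (cardD1 y) -[y \in _]/(adj x y); congr (_ + _).
  by apply: eq_card => z; rewrite !inE andbC.
have eqAB : A = B.
  apply/eqP; rewrite eqEcard; apply/andP; split.
    apply/subsetP => x; rewrite !inE => /andP[ux xv].
    have xu : x != u by apply: contraTneq ux => ->; rewrite adj_irr.
    by rewrite xu dom_uv.
  by move: deg_uv; rewrite (card_nbr u v) (card_nbr v u) adj_sym => /addnI ->.
by move/setP/(_ w): eqAB; rewrite !inE wu wv !andbT.
Qed.

Lemma automorphism_degree (G : sgraph) (p : {perm G}) (u : G) :
  automorphism p -> #|adj (p u)| = #|adj u|.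
Proof.
move=> /automorphismP aut_p; rewrite -(card_imset (adj u) (@perm_inj _ p)).
apply: eq_card => v; rewrite -[v](permKV p) mem_imset; last exact: perm_inj.
by rewrite -!topredE /= aut_p.
Qed.

(** Here [f] numbers the twin classes and [L] is the size of a largest one. Numbers are used so that
    class sizes can later be read as multiplicities in a list. *)
Lemma distinguishing_number_twins (G : sgraph) (f : G -> nat) (L : nat) :
  (forall u v : G, dominated u v \/ dominated v u) ->
  (forall u v : G, f u = f v <-> twins u v) ->
  (forall x, #|[set w | f w == x]| <= L) ->
  (exists x, #|[set w | f w == x]| = L) ->
  distinguishing_number G = L.
Proof.
move=> nested twinP leL [x cardL].
rewrite /distinguishing_number; case: ex_minnP => c /existsP[phi dist_phi] minc.
apply/eqP; rewrite eqn_leq; apply/andP; split; last first.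
  rewrite -cardL -[c]card_ord -(@card_in_imset _ _ phi).
    exact: max_card.
  move=> u v; rewrite !inE => /eqP fu /eqP fv; apply: distinguishing_twins => //.
  by apply/twinP; rewrite fu fv.
(* The label of a vertex is its rank in the enumeration of its class. *)
apply: minc; pose cl v := enum [set w | f w == f v].
have lt_index v : index v (cl v) < L.
  by apply: leq_trans (leL (f v)); rewrite cardE index_mem mem_enum inE.
apply/existsP; exists [ffun v => Ordinal (lt_index v)].
apply/forallP => p; apply/implyP => /andP[aut_p]; apply: contraNT.
rewrite negb_exists => /forallP fix_p; apply/eqP/permP => v; rewrite perm1.
have twin_p : twins v (p v).
  case: (nested v (p v)) => dom_p.
    by apply: dominated_degree => //; rewrite automorphism_degree.
  have twin' : twins (p v) v by apply: dominated_degree => //; rewrite automorphism_degree.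
  by move=> w wv wp; rewrite twin'.
have eq_cl : cl v = cl (p v) by rewrite /cl; have /twinP -> := twin_p.
move: (fix_p v); rewrite negbK !ffunE -val_eqE /= eq_cl => /eqP eq_index.
have in_cl w : w \in cl w by rewrite mem_enum inE.
by rewrite -(nth_index v (in_cl (p v))) -eq_index nth_index // -eq_cl.
Qed.

(** * Triviality of the canonical components *)

Definition embeds (G H : sgraph) : Prop :=
  exists2 f : G -> H, injective f & forall u v, adj (f u) (f v) = adj u v.

Lemma embeds_comp_l (G : ksgraph) (H T : sgraph) :
  embeds (Defs.comp G H) T -> embeds G T.
Proof.
case=> f inj_f fP; exists (f \o inl) => [u v /inj_f[] //|u v].
by rewrite /= fP.
Qed.

Lemma embeds_comp_r (G : ksgraph) (H T : sgraph) :
  embeds (Defs.comp G H) T -> embeds H T.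
Proof.
case=> f inj_f fP; exists (f \o inr) => [u v /inj_f[] //|u v].
by rewrite /= fP.
Qed.

(** Among the vertices in the image of [H], the one added last was joined to all or to none of the
    others, which were already present. *)
Lemma embeds_threshold (H : sgraph) (bs : seq bool) :
  embeds H (foldr add_vertex empty_graph bs) -> 0 < #|H| ->
  exists (v : H) (b : bool), forall w, w != v -> adj v w = b.
Proof.
elim: bs => [|b bs IH] /= [f inj_f fP] /card_gt0P[v0 _]; first by case: (f v0).
case: (pickP (fun v => f v == None)) => [v /eqP fv | fN].
  exists v, b => w wv; rewrite -fP fv.
  by case fw: (f w) => //; case/eqP: wv; apply: inj_f; rewrite fw fv.
apply: IH; last by apply/card_gt0P; exists v0.
have /fin_all_exists[g fg] v : exists u, f v = Some u.
  by case fv: (f v) (fN v) => [u|] // _; exists u.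
exists g => [u v uv | u v]; first by apply: inj_f; rewrite !fg uv.
by rewrite -fP !fg.
Qed.

Section RemoveVertex.
Variables (G : sgraph) (v : G).
Definition remove_adj (x y : {w : G | w != v}) : bool := adj (val x) (val y).
Lemma remove_adj_sym : symmetric remove_adj.
Proof. by move=> x y; apply: adj_sym. Qed.
Lemma remove_adj_irr : irreflexive remove_adj.
Proof. by move=> x; apply: adj_irr. Qed.
Definition remove_vertex : sgraph := SGraph remove_adj_sym remove_adj_irr.
End RemoveVertex.

(** The vertex [v] splits off as an outer component, of type [K1] if it is dominating and [S1] if it
    is isolated. *)
Lemma uniform_vertex_decomposable (G : sgraph) (v : G) (b : bool) :
  (forall w, w != v -> adj v w = b) -> 1 < #|G| -> decomposable G.
Proof.
move=> vP G_gt1; exists (run (if b then K1 else S1) 1), (remove_vertex v).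
split; first by rewrite card_ord.
  rewrite card_sig; move: G_gt1; rewrite (cardD1 v) inE add1n ltnS.
  by rewrite (eq_card (B := [pred w | w != v])) // => w; rewrite !inE andbT.
pose f (w : G) : Defs.comp (run (if b then K1 else S1) 1) (remove_vertex v) :=
  if insub w is Some w' then inr w' else inl ord0.
have fv : f v = inl ord0 by rewrite /f insubF ?eqxx.
have fN w (wv : w != v) : f w = inr (Sub w wv) by rewrite /f insubT.
have in_run1 : (ord0 : run_graph (if b then K1 else S1) 1)
    \in run_A (if b then K1 else S1) 1 = b by rewrite inE; case: (b).
exists f.
  exists (fun y => if y is inr w then val w else v).
    by move=> w; case: (eqVneq w v) => [->|wv]; rewrite ?fv ?(fN _ wv).
  by case=> [i|w]; [rewrite fv [i]ord1 | rewrite (fN _ (valP w)); congr inr; apply: val_inj].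
move=> x y; case: (eqVneq x v) => [->|xv]; case: (eqVneq y v) => [->|yv].
- by rewrite !adj_irr.
- by rewrite fv (fN _ yv) vP //= in_run1.
- by rewrite fv (fN _ xv) [adj x v]adj_sym vP //= in_run1.
- by rewrite (fN _ xv) (fN _ yv).
Qed.

Lemma indecomposable_threshold (H : sgraph) (bs : seq bool) :
  embeds H (foldr add_vertex empty_graph bs) -> indecomposable H -> #|H| <= 1.
Proof.
move=> emb ind; rewrite leqNgt; apply/negP => H_gt1; apply: ind.
have [v [b vP]] := embeds_threshold emb (ltnW H_gt1).
exact: uniform_vertex_decomposable vP H_gt1.
Qed.

Lemma threshold_components (s : seq ksgraph) (G0 : sgraph) (bs : seq bool) :
  embeds (recompose (s, G0)) (foldr add_vertex empty_graph bs) ->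
  all_components indecomposable s G0 ->
  all_components (fun H => #|H| <= 1) s G0.
Proof.
elim: s => [|G s IH] /= emb; first exact: indecomposable_threshold emb.
case=> indG inds; split; last exact: IH (embeds_comp_r emb) inds.
exact: indecomposable_threshold (embeds_comp_l emb) indG.
Qed.

(** * Positions of the vertices and runs of equal types *)

Definition dominating_types (s : seq ksgraph) : seq bool :=
  [seq ksA G == [set: G] | G : ksgraph <- s].

Lemma card1_eq (T : finType) (x y : T) : #|T| = 1 -> x = y.
Proof. by move/fintype1 => [z zP]; rewrite (zP x) (zP y). Qed.

(** Positions go from the outermost component inwards, and the outer of two vertices decides
    adjacency, hence the minimum. The default [x0] stands for the type of [G0]; it is left free so
    that the type of the preceding component can be chosen. *)
Lemma trivial_recompose (s : seq ksgraph) (G0 : sgraph) (x0 : bool) :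
  all_components (fun H => #|H| = 1) s G0 ->
  exists2 g : recompose (s, G0) -> 'I_(size s).+1, bijective g &
    forall u v, adj u v = (u != v) &&
      nth x0 (dominating_types s) (minn (g u) (g v)).
Proof.
elim: s => [|G s IH] /=.
  move=> card1; exists (fun=> ord0).
    by apply: inj_card_bij => [u v _|]; [apply: card1_eq | rewrite card_ord card1].
  by move=> u v; rewrite (card1_eq u v card1) eqxx adj_irr.
case=> cardG /IH[g bij_g gP].
pose h (x : Defs.comp G (recompose (s, G0))) : 'I_(size s).+2 :=
  if x is inr u then lift ord0 (g u) else ord0.
exists h.
  apply: inj_card_bij => [[u|u] [v|v]|] //=.
  - by rewrite (card1_eq u v cardG).
  - by move/lift_inj/(bij_inj bij_g) => ->.
  - by rewrite card_sum cardG (bij_eq_card bij_g) !card_ord.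
have memA u : (u \in ksA G) = (ksA G == [set: G]).
  apply/idP/eqP => [uA|->]; last by rewrite inE.
  by apply/setP => v; rewrite (card1_eq v u cardG) uA inE.
case=> [u|u] [v|v] //=; rewrite ?memA ?minn0 ?min0n //.
  by rewrite (card1_eq u v cardG) eqxx adj_irr.
by rewrite gP /bump !leq0n !add1n minnSS.
Qed.

(* The indices of the runs met by [s] and by one more entry that repeats the
   last one, when [s] is read after an entry [b] of run [k]. *)
Fixpoint run_index (b : bool) (k : nat) (s : seq bool) : seq nat :=
  if s is c :: s' then
    let k' := k + (b != c) in k' :: run_index c k' s'
  else [:: k].

Lemma size_run_index b k s : size (run_index b k s) = (size s).+1.
Proof. by elim: s b k => //= c s IH b k; rewrite IH. Qed.

Lemma run_index_ge b k s x : x < k -> count_mem x (run_index b k s) = 0.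
Proof.
elim: s b k => [|c s IH] b k lt_xk /=; first by rewrite gtn_eqF.
by rewrite IH ?gtn_eqF ?ltn_addr.
Qed.

(** The default [last b s] makes the position just past the list repeat the last type, which puts
    [G0] in the run of its predecessor. *)
Lemma nth_run_index b k s i : i <= size s ->
  nth 0 (k :: run_index b k s) i.+1 = nth 0 (k :: run_index b k s) i +
    (nth (last b s) (b :: s) i != nth (last b s) (b :: s) i.+1).
Proof.
elim: s b k i => [|c s IH] b k [|i] //=; first by rewrite eqxx addn0.
by rewrite ltnS => /(IH c (k + (b != c))).
Qed.

Lemma largest_component_cons (H : ksgraph) (d : decomposition) :
  largest_component (H :: d.1, d.2) = maxn #|H| (largest_component d).
Proof. by rewrite /largest_component big_cons maxnCA. Qed.

(** The pending run has index [k] and its [m] vertices are the copies of [k] in front.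
    Multiplicities in [l] are then run sizes, and [L] is their maximum. *)
Lemma compact_scan_run_index t m k (s : seq ksgraph) (G0 : sgraph) :
  all_components (fun H => #|H| = 1) s G0 ->
  let l := nseq m k ++ run_index (is_K1 t) k (dominating_types s) in
  let L := largest_component (compact_scan (Some (t, m)) s G0) in
  (forall x, count_mem x l <= L) /\ exists x, count_mem x l = L.
Proof.
elim: s t m k => [|G s IH] t m k /=.
  move=> ->; rewrite eqxx /largest_component /= big_nil card_ord maxn0.
  split=> [x|]; last by exists k; rewrite count_cat count_nseq /= eqxx; lia.
  by rewrite count_cat count_nseq /=; case: eqP; lia.
case=> cardG cards; rewrite /trivial_type cardG eqxx.
set c := ksA G == _; set t' := if c then K1 else S1.
have -> : c = is_K1 t' by rewrite /t'; case: (c).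
rewrite eq_sym; case: eqP => [tt'|neq].
  have {IH} := IH t' m.+1 k cards; rewrite /= tt' addn0.
  have count_l x l : count_mem x (nseq m k ++ k :: l) =
      (k == x) + count_mem x (nseq m k ++ l) by rewrite !count_cat /= addnCA.
  case=> leL [x eqL]; split=> [y|]; first by rewrite count_l.
  by exists x; rewrite count_l.
(* The type changes: run [k] is closed with [m] vertices, and all later indices exceed [k]. *)
rewrite largest_component_cons card_ord addn1.
have [leL [x eqL]] := IH t' 1 k.+1 cards.
set L := largest_component _ in leL eqL *; rewrite /= in leL eqL.
have count_k y : count_mem y (nseq m k) = (k == y) * m by rewrite count_nseq.
have count_r y : y = k -> (k.+1 == y) +
    count_mem y (run_index (is_K1 t') k.+1 (dominating_types s)) = 0.
  by move=> ->; rewrite run_index_ge // gtn_eqF.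
split=> [y|]; first rewrite count_cat count_k /=.
  case: (eqVneq k y) => [ky|_]; last by rewrite (leq_trans (leL y)) ?leq_maxr.
  by rewrite count_r // mul1n addn0 leq_maxl.
case: (leqP m L) => leq_mL.
  (* If [x] is [k], its count in the tail is 0, so [L] and [m] are both 0. *)
  case: (eqVneq k x) => [kx|kx].
    exists k; rewrite count_cat count_k /= count_r // eqxx; move: eqL; rewrite count_r //; lia.
  by exists x; rewrite count_cat count_k /= (negbTE kx) eqL.
by exists k; rewrite count_cat count_k /= count_r // eqxx mul1n addn0.
Qed.

Lemma card_nth_eq (T : finType) n (g : T -> 'I_n) (l : seq nat) (x : nat) :
  bijective g -> size l = n ->
  #|[set w | nth 0 l (g w) == x]| = count_mem x l.
Proof.
move=> [h gK hK] size_l; rewrite -sum1_count (big_nth 0) size_l big_mkord -sum1dep_card.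
by rewrite (reindex g) //; exists h => i _.
Qed.

(** The index [r] never decreases and grows exactly where [b] changes. *)
Lemma eq_run_index n (b : nat -> bool) (r : nat -> nat) i j :
  (forall k, k < n -> r k.+1 = r k + (b k != b k.+1)) ->
  i <= j <= n -> r i = r j <-> forall k, i <= k <= j -> b k = b i.
Proof.
move=> rS /andP[le_ij le_jn].
have r_mono k l : k <= l -> l <= n -> r k <= r l.
  elim: l => [|l IH]; first by rewrite leqn0 => /eqP ->.
  rewrite leq_eqVlt => /predU1P[-> //|le_kl] lt_ln.
  by rewrite rS // (leq_trans (IH le_kl (ltnW lt_ln))) ?leq_addr.
split=> [r_ij | const_b].
  elim=> [|k IH]; first by rewrite leqn0 => /andP[/eqP ->].
  case/andP; rewrite leq_eqVlt => /predU1P[-> //|].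
  rewrite ltnS => le_ik lt_kj; rewrite -IH ?le_ik ?(ltnW lt_kj) //.
  case: (eqVneq (b k) (b k.+1)) => // neq_b.
  have lt_kn := leq_trans lt_kj le_jn.
  have := r_mono _ _ lt_kj le_jn; rewrite rS // neq_b -r_ij => r_ki.
  by have := r_mono i k le_ik (ltnW lt_kn); lia.
elim: j le_ij le_jn {r_mono} const_b => [|j IH]; first by rewrite leqn0 => /eqP ->.
rewrite leq_eqVlt => /predU1P[-> //|]; rewrite ltnS => le_ij lt_jn const_b.
rewrite rS // (const_b j.+1) ?(const_b j) ?eqxx ?addn0 ?le_ij ?leqnSn ?leqnn ?(leqW le_ij) //.
by apply: IH => // [|k /andP[le_ik le_kj]]; [apply: ltnW | rewrite const_b // le_ik leqW].
Qed.

(** * Runs as twin classes *)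

Section Positions.
Variables (G : sgraph) (n : nat) (g : G -> 'I_n.+2) (b : nat -> bool).
Hypothesis adjE : forall u v, adj u v = (u != v) && b (minn (g u) (g v)).

(** Vertices before both [u] and [v] do not separate them. The earlier of the two is adjacent to
    everything after it or to nothing after it, according to its type. *)
Lemma positions_nested (u v : G) : dominated u v \/ dominated v u.
Proof.
wlog le_uv : u v / g u <= g v.
  by move=> W; case: (leqP (g u) (g v)) => [/W //|/ltnW/W[]]; [right|left].
case bu: (b (g u)); [right|left] => w wu wv; rewrite !adjE ![_ == w]eq_sym wu wv /=.
all: case: (leqP (g w) (g u)) => [le_wu|lt_uw].
- by rewrite (minn_idPr (leq_trans le_wu le_uv)).
- by rewrite bu.
- by rewrite (minn_idPr (leq_trans le_wu le_uv)).
- by rewrite bu.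
Qed.

Lemma positions_twins (r : nat -> nat) (u v : G) :
  bijective g -> b n.+1 = b n ->
  (forall k, k < n.+1 -> r k.+1 = r k + (b k != b k.+1)) ->
  r (g u) = r (g v) <-> twins u v.
Proof.
move=> [h gK hK] b_last rS.
wlog le_uv : u v / g u <= g v.
  move=> W; case: (leqP (g u) (g v)) => [/W //|/ltnW/W[r_tw tw_r]].
  split=> [/esym/r_tw tw w wu wv|tw]; first by rewrite tw.
  by apply/esym/tw_r => w wv wu; rewrite tw.
have le_vn : g v <= n.+1 by rewrite -ltnS.
rewrite (eq_run_index rS); last by rewrite le_uv.
split=> [const_b w wu wv | tw].
  rewrite !adjE ![_ == w]eq_sym wu wv /=.
  case: (leqP (g w) (g u)) => [le_wu|lt_uw].
    by rewrite (minn_idPr (leq_trans le_wu le_uv)).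
  by apply/esym/const_b; lia.
(* The twin condition is tested on the vertex [w] at position [k]. *)
have twin_at k : k <= n.+1 -> g u < k -> k != g v -> b (minn (g v) k) = b (g u).
  move=> le_kn lt_uk neq_kv; pose w := h (inord k).
  have gw : g w = k :> nat by rewrite hK inordK.
  have wu : w != u by apply: contraTneq lt_uk => wu; rewrite -gw wu ltnn.
  have wv : w != v by apply: contraNneq neq_kv => wv; rewrite -gw wv.
  have := tw w wu wv; rewrite !adjE ![_ == w]eq_sym wu wv /= gw => <-.
  by rewrite (minn_idPl (ltnW lt_uk)).
have inner k : g u <= k -> k < g v -> b k = b (g u).
  rewrite leq_eqVlt => /predU1P[<- //|lt_uk] lt_kv.
  by rewrite -(twin_at k) ?(minn_idPr (ltnW lt_kv)) ?(ltn_eqF lt_kv) //; lia.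
move=> k /andP[le_uk]; rewrite leq_eqVlt => /predU1P[->|]; last exact: inner.
move: le_uv; rewrite leq_eqVlt => /predU1P[-> //|lt_uv].
(* Only a vertex after [v] can reveal [b (g v)]. If [v] is last, [b_last] moves the question one
   position back; otherwise the vertex in the last position serves. *)
move: le_vn; rewrite leq_eqVlt => /predU1P[gv|lt_vn].
  by move: lt_uv; rewrite gv ltnS b_last => /inner; apply; rewrite gv.
by rewrite -(twin_at n.+1) ?(minn_idPl (ltnW lt_vn)) ?(gtn_eqF lt_vn) // (ltn_trans lt_uv).
Qed.

End Positions.

Theorem corollary3p5 (G : sgraph) (d : decomposition) :
  threshold G -> canonical_decomposition G d ->
  distinguishing_number G = largest_component (compact d).
Proof.
case: d => s G0 [bs [f bij_f fP]] [[f' bij_f' f'P] /= ind pos].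
have emb : embeds (recompose (s, G0)) (foldr add_vertex empty_graph bs).
  have [e f'K eK] := bij_f'; exists (f \o e) => [u v /(bij_inj bij_f)|u v].
    exact: (can_inj eK).
  by rewrite fP -f'P !eK.
have {emb ind} le1 := threshold_components emb ind.
(* With [G0] as the only component, [G] has at most one vertex, possibly none, and a constant
   numbering of classes suffices. *)
case: s f' bij_f' f'P pos le1 => [|H s] f' bij_f' f'P.
  move=> _ /= leG0; rewrite /compact /largest_component /= big_nil maxn0.
  have cardG : #|G| = #|G0| := bij_eq_card bij_f'.
  have eqG (u v : G) : u = v.
    by have /fintype_le1P/(_ u v) : #|G| <= 1 by rewrite cardG.
  apply: (@distinguishing_number_twins _ (fun=> 0)) => [u v|u v|x|].
  - by left; rewrite (eqG u v) => w.
  - by split=> // _; rewrite (eqG u v) => w.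
  - by rewrite -cardG max_card.
  - by exists 0; rewrite -cardG -cardsT; congr #|pred_of_set _|; apply/setP => x; rewrite !inE.
move=> /(_ ltac:(by [])) pos le1.
have {pos le1} card1 : all_components (fun H => #|H| = 1) (H :: s) G0.
  elim: (H :: s) pos le1 => [|K t IH] /=.
    by move=> ? ?; apply/eqP; rewrite eqn_leq; apply/andP.
  case=> K_gt0 pos [K_le1 le1]; split; last exact: IH.
  by apply/eqP; rewrite eqn_leq K_le1.
set c := ksA H == [set: H]; set ts := dominating_types s.
(* The default [last c ts] gives [G0] the type of the component just before it. *)
have [g bij_g gP] := trivial_recompose (last c ts) card1.
have bij_gf : bijective (g \o f') := bij_comp bij_g bij_f'.
have adjE u v : adj u v = (u != v) &&
    nth (last c ts) (c :: ts) (minn ((g \o f') u) ((g \o f') v)).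
  by rewrite -f'P gP (inj_eq (bij_inj bij_f')).
pose t := if c then K1 else S1.
have tE : is_K1 t = c by rewrite /t; case: (c).
have size_ts : size ts = size s by rewrite size_map.
have [cardH cards] := card1.
have -> : compact (H :: s, G0) = compact_scan (Some (t, 1)) s G0.
  by rewrite /compact /= /trivial_type cardH eqxx.
have := compact_scan_run_index t 1 0 cards; rewrite tE cat1s -/ts.
set l := 0 :: _; set L := largest_component _ => -[leL [x eqL]].
have size_l : size l = (size s).+2 by rewrite /= size_run_index size_ts.
apply: (@distinguishing_number_twins _ (fun u => nth 0 l ((g \o f') u))).
- exact: (positions_nested adjE).
- move=> u v; apply: (@positions_twins _ (size s) _ _ adjE) => //.
    by rewrite -size_ts nth_default // -[size ts]/(size (c :: ts)).-1 nth_last.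
  by move=> k lt_k; rewrite nth_run_index // size_ts.
- by move=> y; rewrite (card_nth_eq _ bij_gf).
- by exists x; rewrite (card_nth_eq _ bij_gf).
Qed.
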